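(* Let $G$ be a finite group and let $H$ be an abelian subgroup of $G$. Then for every irreducible representation $\varphi$ of $G$ over $\mathbb C$, $\deg\varphi\le [G:H]$.
   Context: $\deg\varphi$ is the dimension of the representation and $[G:H]$ is the index of $H$ in $G$. *)

(* Defs.v *)
From HB Require Import structures.
From mathcomp Require Export all_boot all_order all_algebra all_fingroup.
From mathcomp Require Export mxrepresentation reals complex.

Set Implicit Arguments.
Unset Strict Implicit.
Unset Printing Implicit Defensive.

(* Main.v *)
Require Import Defs.
From mathcomp Require Import spectral.

Set Implicit Arguments.
Unset Strict Implicit.
Unset Printing Implicit Defensive.

Local Open Scope group_scope.

(** The commuting matrices [phi h], for [h] in [H], have a common eigenvector
    [v]. By irreducibility the vectors [v *m phi g], for [g] in [G], span the
    whole space; up to a scalar [v *m phi g] only depends on the coset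
    [H :* g], so [#|G : H|] of these vectors suffice. *)

Lemma abelian_repr_eigenvector (C : numClosedFieldType) (gT : finGroupType)
    (H : {group gT}) (n : nat) (rH : mx_representation C H n) :
    abelian H -> (n > 0)%N ->
  exists2 v : 'rV_n, v != 0%R & {in H, forall h, stablemx v (rH h)}.
Proof.
move=> abH n_gt0.
have [|v nz_v /allP stab_v] :=
  @common_eigenvector C n [seq rH h | h <- enum H] n_gt0.
  move=> _ _ /mapP[h + ->] /mapP[k + ->]; rewrite !mem_enum => Hh Hk.
  by rewrite /comm_mx -!repr_mxM // (centsP abH h Hh k Hk).
exists v => // h Hh.
by apply: stab_v; rewrite map_f // mem_enum.
Qed.

Lemma cyclic_mx_rank_index (F : fieldType) (gT : finGroupType)
    (G H : {group gT}) (n : nat) (rG : mx_representation F G n) (v : 'rV_n) :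
    H \subset G -> {in H, forall h, stablemx v (rG h)} ->
  (\rank (cyclic_mx rG v) <= #|G : H|)%N.
Proof.
move=> sHG stab_v.
(* One row per right coset, so the row count of [M] is the index and bounds its rank. *)
pose M := (\matrix_(i < #|rcosets H G|) (v *m rG (repr (enum_val i))))%R.
suff sM : (cyclic_mx rG v <= M)%MS.
  by apply: leq_trans (mxrankS sM) (rank_leq_row M).
(* The generating rows are the vectors [v *m rG x] for [x] in [G]. *)
rewrite genmxE; apply/row_subP=> i.
rewrite row_mul mul_rV_lin1 /= rowK mxvecK.
move: (enum_val i) (enum_valP i) => x Gx.
have HxG : H :* x \in rcosets H G by rewrite mem_rcosets mulSGid.
have /rcosetP[h Hh def_r] := mem_repr_rcoset H x.
have {def_r} def_x : x = h^-1 * repr (H :* x) by rewrite def_r mulKg.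
have Hh1 : h^-1 \in H by rewrite groupV.
have Gr : repr (H :* x) \in G.
  by rewrite -(mulKVg h (repr _)) -def_x groupM // (subsetP sHG).
(* Row vectors are acted on from the right, so [h^-1] meets [v] first and only rescales it; this is
   why right cosets are used. *)
rewrite [in rG x]def_x repr_mxM ?(subsetP sHG _ Hh1) // mulmxA.
apply: submx_trans (submxMr _ (stab_v _ Hh1)) _.
have -> : (v *m rG (repr (H :* x)))%R = row (enum_rank_in HxG (H :* x)) M.
  by rewrite rowK enum_rankK_in.
exact: row_sub.
Qed.

(* The field of complex numbers is R[i], for R the real numbers. *)
Theorem corollary1p8 (R : realType) (gT : finGroupType) (G H : {group gT})
  (sHG : H \subset G) (abH : abelian H)
  (n : nat) (phi : mx_representation R[i] G n) (irr_phi : mx_irreducible phi) :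
  (n <= #|G : H|)%N.
Proof.
have /mx_irrP[n_gt0 full_phi] := irr_phi.
have [v nz_v stab_v] := abelian_repr_eigenvector (subg_repr phi sHG) abH n_gt0.
(* A nonzero submodule of an irreducible module is everything, so [n] is the rank of the one
   generated by [v]. *)
have /eqP <- : row_full (cyclic_mx phi v).
  by rewrite full_phi ?cyclic_mx_module // cyclic_mx_eq0.
exact: cyclic_mx_rank_index.
Qed.
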